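(* Fix $p \in (0,1)$. Then, as $n \to \infty$, \[ \mathcal{E}_p(S_n) \le \Big(\frac{1+\sqrt{1-p}}{p}\Big) n + o_p(n). \]
   Context: For $\sigma\in S_n$, $i\in[n-1]$ is a descent if $\sigma(i)>\sigma(i+1)$; $\mathrm{Des}(\sigma)$ is the set of descents. For $T\subseteq \mathrm{Des}(\sigma)$, the Ungar move associated to $T$ reverses every descent in $T$, where maximal runs of consecutive indices in $T$ are treated as blocks that are reversed (e.g. for $\sigma=416523$, $T=\{3,4\}$ gives $412563$). Equivalently, viewing $S_n$ as a lattice under the right weak order, it sends $\sigma$ to the meet of $\sigma$ together with the elements $\sigma\circ(i\ i{+}1)$, $i\in T$. A random Ungar move with parameter $p$ includes each descent in $T$ independently with probability $p$ and applies the associated Ungar move; the Ungarian Markov chain on $S_n$ is the Markov chain whose transitions are random Ungar moves. $\mathcal{E}_p(S_n)$ is the expected number of steps for this chain, started at the decreasing permutation $n(n-1)\cdots 1$, to reach the identity $12\cdots n$. The $o_p(n)$ term depends on $p$ and $n$ only. *)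

(* Defs.v *)
From HB Require Import structures.
From mathcomp Require Import all_boot all_order all_algebra all_fingroup.
From mathcomp Require Import all_classical all_reals all_analysis.
Set Implicit Arguments. Unset Strict Implicit. Unset Printing Implicit Defensive.
Import Order.TTheory GRing.Theory Num.Theory.
Local Open Scope ring_scope.

(* Permutations of [n] are modelled as {perm 'I_n}, positions/values 0-based.
   A descent at (1-based) index i+1 corresponds to the 0-based position
   i : 'I_n with i.+1 < n and s i > s (i+1). *)

Section Ungar.
Variable n : nat.
Implicit Types (s : {perm 'I_n}) (T : {set 'I_n}).

(* the next position i+1 (defaults to i when i+1 is out of range) *)
Definition ord_succ (i : 'I_n) : 'I_n := insubd i i.+1.

Definition Des s : {set 'I_n} :=
  [set i : 'I_n | (i.+1 < n)%N && (s (ord_succ i) < s i)%N].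

(* For a set T of descent positions (position i means the adjacent pair
   (i, i+1)), runR T j = number of consecutive positions j, j+1, ... in T,
   runL T j = number of consecutive positions j-1, j-2, ... in T.
   Position j lies in a block [j - runL, j + runR] which gets reversed,
   so the entry at position j of the new permutation is the old entry at
   position (j - runL) + (j + runR) - j = j + runR - runL. *)
Definition inT T (k : nat) : bool := [exists i in T, val i == k].
Definition runR T (j : nat) : nat := find (fun m => ~~ inT T (j + m)) (iota 0 n).
Definition runL T (j : nat) : nat :=
  find (fun m => (j <= m)%N || ~~ inT T (j - m.+1)) (iota 0 n).

Definition ungar_fun s T : {ffun 'I_n -> 'I_n} :=
  [ffun j : 'I_n => s (insubd j (j + runR T j - runL T j)%N)].

(* The Ungar move associated to T ⊆ Des s.  The result is always a
   permutation (block reversal); insubd only packages it as such. *)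
Definition ungar s T : {perm 'I_n} := insubd s (ungar_fun s T).

Definition ungar_trans {R : realType} (p : R) s s' : R :=
  \sum_(T in powerset (Des s) | ungar s T == s')
     p ^+ #|T| * (1 - p) ^+ (#|Des s| - #|T|).

Definition perm_dec : {perm 'I_n} := perm (@rev_ord_inj n).
Definition perm_id : {perm 'I_n} := 1%g.

(* alive R p t s = P(X_t = s and X_u <> id for all u <= t), chain started
   at the decreasing permutation *)
Fixpoint alive {R : realType} (p : R) (t : nat) : {ffun {perm 'I_n} -> R} :=
  match t with
  | 0 => [ffun s => if (s == perm_dec) && (s != perm_id) then 1 else 0]
  | t'.+1 => [ffun s' => if s' != perm_id then
                 \sum_(s : {perm 'I_n}) alive p t' s * ungar_trans p s s'
               else 0]
  end.

(* E_p(S_n) = E[hitting time of id] = sum_{t>=0} P(tau > t), in \bar R *)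
Definition expected_steps {R : realType} (p : R) : \bar R :=
  (\sum_(t <oo) (\sum_(s : {perm 'I_n}) alive p t s)%:E)%E.

End Ungar.

(* Main.v *)
Require Import Defs.
From HB Require Import structures.
From mathcomp Require Import all_boot all_order all_algebra all_fingroup.
From mathcomp Require Import all_classical all_reals all_analysis.
From mathcomp Require Import zify ring lra.
Set Implicit Arguments. Unset Strict Implicit. Unset Printing Implicit Defensive.
Import Order.TTheory GRing.Theory Num.Theory.
Local Open Scope ring_scope.

(* Replacing each value by the bit saying whether it is at least [k] turns a
   permutation into a 0/1 word, and [s] is the identity iff all its words are
   sorted.  On a word, a random Ungar move is at least as advanced as one step
   of discrete-time TASEP in which each corner [true, false] is independently
   swapped with probability [p].  The time TASEP needs to sort a word is a
   last-passage time with geometric weights, whose stationary version has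
   independent geometric increments of parameter [q] along every down-right
   path, where [q ^+ 2 = 1 - p].  Let [Phi(w)] be the expected maximum, over
   the corners of [w], of [x ^ (I_1 + .. + I_a - J_1 - .. - J_b)], where
   [a] and [b] count the bits [true] and [false] before the corner and the [I],
   [J] are independent geometric.  The Burke property of a corner shows that
   one TASEP step multiplies the mean of [Phi] by at most [x^-1].  Since an
   unsorted word has [Phi >= (E x^-J)^b] and the initial word has
   [Phi = (E x^I)^a], letting [x] tend to [1] bounds the probability that a
   word is unsorted at time [t > (E I + eps) n = (1 / (1 - q) + eps) n] by an
   exponentially small quantity, which absorbs the union bound over the [n]
   thresholds [k].  The geometric expectations are truncated to their first [N]
   terms, so that only finite sums occur; [N] grows by one with each step. *)

(** * A potential for discrete-time TASEP *)

Section GeometricPotential.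
Variables (R : realType) (q x : R).
Hypotheses (q_gt0 : 0 < q) (q_lt1 : q < 1) (x_ge1 : 1 <= x).

Let x_gt0 : 0 < x. Proof. exact: lt_le_trans x_ge1. Qed.
Let xn0 : x != 0. Proof. by rewrite gt_eqF. Qed.
Let expx_ge1 i : 1 <= x ^+ i. Proof. exact: exprn_ege1. Qed.
Let expx_gt0 i : 0 < x ^+ i. Proof. exact: exprn_gt0. Qed.
Let wgt_ge0 i : 0 <= (1 - q) * q ^+ i.
Proof. by rewrite mulr_ge0 ?subr_ge0 ?exprn_ge0 // ltW. Qed.

Definition geo (N : nat) (f : nat -> R) : R :=
  \sum_(i < N) (1 - q) * q ^+ i * f i.

Lemma geo_le N f h : (forall i, f i <= h i) -> geo N f <= geo N h.
Proof. by move=> fh; apply: ler_sum => i _; apply: ler_wpM2l. Qed.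

Lemma eq_geo N f h : f =1 h -> geo N f = geo N h.
Proof. by move=> fh; apply: eq_bigr => i _; rewrite fh. Qed.

Lemma geo_ge0 N f : (forall i, 0 <= f i) -> 0 <= geo N f.
Proof. by move=> f0; apply: sumr_ge0 => i _; apply: mulr_ge0. Qed.

Lemma geo_leS N f : (forall i, 0 <= f i) -> geo N f <= geo N.+1 f.
Proof. by move=> f0; rewrite /geo big_ord_recr lerDl mulr_ge0. Qed.

Lemma geoMr N f c : geo N (fun i => f i * c) = geo N f * c.
Proof. by rewrite /geo big_distrl; apply: eq_bigr => i _; rewrite !mulrA. Qed.

Lemma geo1 N : geo N (fun=> 1) = 1 - q ^+ N.
Proof.
rewrite /geo; under eq_bigr do rewrite mulr1; rewrite -big_distrr.
by rewrite -[RHS]opprB subrX1 -mulNr opprB.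
Qed.

Let quad N (F : nat -> nat -> R) : R :=
  \sum_(i < N) \sum_(j < N) q ^+ i * q ^+ j * F i j.

Let axis N (F : nat -> nat -> R) : R :=
  F 0 0 + \sum_(j < N) q ^+ j.+1 * F 0 j.+1 + \sum_(i < N) q ^+ i.+1 * F i.+1 0.

Let quadS N F :
  quad N.+1 F = axis N F + q ^+ 2 * quad N (fun i j => F i.+1 j.+1).
Proof.
rewrite /quad big_ord_recl big_ord_recl /= !expr0 !mul1r.
under [X in _ + X + _ = _]eq_bigr do rewrite mul1r.
under [X in _ + _ + X = _]eq_bigr do rewrite big_ord_recl /= expr0 mulr1.
rewrite big_split /= /axis addrA; congr (_ + _).
rewrite big_distrr; apply: eq_bigr => i _; rewrite big_distrr; apply: eq_bigr => j _.
by rewrite /bump /= !add1n !exprS; ring.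
Qed.

Let geo_quad N F : geo N (fun i => geo N (F i)) = (1 - q) ^+ 2 * quad N F.
Proof.
rewrite /geo /quad big_distrr; apply: eq_bigr => i _.
rewrite big_distrr big_distrr; apply: eq_bigr => j _ /=; ring.
Qed.

(* Burke property of a corner: if [I], [J] are independent geometric of
   parameter [q], then [(I, J)] is distributed as [(I + 1, J + 1)] with
   probability [q ^+ 2], and as the two positive parts of [I - J] otherwise.
   Truncating the sums only leaves an inequality. *)
Lemma geo_burke N (F : nat -> nat -> R) : (forall i j, 0 <= F i j) ->
  q ^+ 2 * geo N (fun i => geo N (fun j => F i.+1 j.+1)) +
  (1 - q ^+ 2) * geo N (fun i => geo N (fun j => F (i - j)%N (j - i)%N))
  <= geo N.+1 (fun i => geo N.+1 (F i)).
Proof.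
move=> F0; rewrite !geo_quad quadS.
set G := fun i j => F (i - j)%N (j - i)%N.
(* [G] is invariant under the diagonal shift and agrees with [F] on the axes, so splitting off the
   axes of the larger square returns [quad N G] itself. *)
have quadG : quad N G <= axis N F + q ^+ 2 * quad N G.
  have <- : quad N.+1 G = axis N F + q ^+ 2 * quad N G.
    by rewrite quadS.
  rewrite /quad big_ord_recr /=; apply: ler_wpDr.
    by apply: sumr_ge0 => j _; rewrite !mulr_ge0 ?exprn_ge0 ?(ltW q_gt0) //; apply: F0.
  apply: ler_sum => i _; rewrite big_ord_recr /= lerDl.
  by rewrite !mulr_ge0 ?exprn_ge0 ?(ltW q_gt0) //; apply: F0.
have := ler_wpM2l (sqr_ge0 (1 - q)) quadG.
rewrite !mulrDr; lra.
Qed.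

(* Along [w] a multiplicative walk started at [r] is multiplied by [x ^+ i.+1]
   at each [true] and divided by [x ^+ j.+1] at each [false], with independent
   geometric [i], [j]; the potential is the (truncated) expectation of the
   maximum of [m] and of the values of the walk at the corners [true, false].
   The flag [b] says whether the letter before [w] is [true]. *)
Fixpoint potential (N : nat) (w : seq bool) (b : bool) (r m : R) : R :=
  match w with
  | [::] => m
  | true :: w' => geo N (fun i => potential N w' true (r * x ^+ i.+1) m)
  | false :: w' => geo N (fun j =>
      potential N w' false (r / x ^+ j.+1) (if b then Num.max m r else m))
  end.

(** * Monotonicity of the potential in its arguments and in the word *)

Lemma potential_ge0 N w b r m : 0 <= m -> 0 <= potential N w b r m.
Proof.
elim: w b r m => //= -[] w IH b r m m0; apply: geo_ge0 => i; apply: IH => //.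
by case: b; rewrite // le_max m0.
Qed.

Lemma potential_le N w b r m m' :
  m <= m' -> potential N w b r m <= potential N w b r m'.
Proof.
elim: w b r m m' => //= -[] w IH b r m m' mm'; apply: geo_le => i; apply: IH => //.
by case: b; rewrite // ge_max !le_max mm' lexx orbT.
Qed.

(** The flag only lets a leading [false] record the value [r], which [m2] already dominates. *)
Lemma potential_flag N w r m1 m2 : r <= m2 -> m1 <= m2 ->
  potential N w true r m1 <= potential N w false r m2.
Proof.
move=> rm mm; case: w => [//|[] w] /=; apply: geo_le => i; apply: potential_le => //.
by rewrite ge_max mm.
Qed.

Lemma potential_flag_irrel N w r m : head true w ->
  potential N w true r m = potential N w false r m.
Proof. by case: w => [|[]]. Qed.

Lemma potential_cat_le N u w w' :
  (forall b r m, 0 <= r -> potential N w b r m <= potential N w' b r m) ->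
  forall b r m, 0 <= r -> potential N (u ++ w) b r m <= potential N (u ++ w') b r m.
Proof.
move=> ww'; elim: u => //= -[] u IH b r m r0; apply: geo_le => i; apply: IH.
  by rewrite mulr_ge0 // ltW.
by rewrite divr_ge0 // ltW.
Qed.

Lemma geo_swap N (F : nat -> nat -> R) :
  geo N (fun i => geo N (F i)) = geo N (fun j => geo N (fun i => F i j)).
Proof.
rewrite !geo_quad; congr (_ * _); rewrite /quad exchange_big.
by do 2![apply: eq_bigr => ? _]; ring.
Qed.

(** With the same increments for the two letters, both walks reach the same value afterwards. The
    order [true, false] records the peak [r * x ^+ i.+1], which dominates [r] and any corner created
    right after [false, true]. *)
Lemma potential_flip N w b r m : 0 <= r ->
  potential N (false :: true :: w) b r m <= potential N (true :: false :: w) b r m.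
Proof.
move=> r0 /=; rewrite geo_swap; apply: geo_le => i; apply: geo_le => j.
rewrite [r / _ * _]mulrAC.
have rx k : r <= r * x ^+ k by rewrite ler_peMr.
apply: potential_flag.
  rewrite le_max; apply/orP; right.
  by rewrite ler_pdivrMr // ler_peMr // mulr_ge0 // ltW.
by case: b; rewrite ?ge_max !le_max lexx ?rx ?orbT.
Qed.

Lemma potential_move N j w b r m : 0 <= r ->
  potential N (false :: nseq j true ++ w) b r m
    <= potential N (nseq j true ++ false :: w) b r m.
Proof.
elim: j b r m => [//|j IH] b r m r0.
apply: le_trans (potential_flip _ _ _ _ r0) _; rewrite [nseq j.+1 _]/=.
apply: (@potential_cat_le N [:: true]) => // b' r' m' r'0; exact: IH.
Qed.

(** Induction on [u]. If [u] starts with [false], bringing the first [false] of [v] to the front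
    only lowers the potential of [v], and the prefix counts of the remaining letters stay
    ordered. *)
Lemma potential_dominance N u v :
  size u = size v -> count id u = count id v ->
  (forall i, count id (take i u) <= count id (take i v))%N ->
  forall b r m, 0 <= r -> potential N u b r m <= potential N v b r m.
Proof.
elim: u v => [|[] u IH] v.
- by case: v.
- case: v => [//|[] v] /= [sz] ct dom; last by have := dom 1%N; rewrite /= !take0.
  apply: (@potential_cat_le N [:: true]); apply: IH => //; first by lia.
  by move=> i; have := dom i.+1; rewrite /=; lia.
- move=> sz ct dom b r m r0.
  have vF : has negb v.
    rewrite -[has _ _]/(has (predC id) v) has_predC all_count -ct -sz /=.
    by have := count_size id u; lia.
  have [j [w vE]] : exists j, exists w, v = nseq j true ++ false :: w.
    elim: {sz ct dom} v vF => [//|[] v IHv] /=; last by exists 0%N, v.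
    by move=> /IHv[j [w ->]]; exists j.+1, w.
  rewrite vE; apply: le_trans (potential_move _ _ _ _ _ r0).
  apply: (@potential_cat_le N [:: false]) => //; apply: IH.
  - by move: sz; rewrite vE !size_cat /=; lia.
  - by move: ct; rewrite vE !count_cat /=; lia.
  - move=> i; rewrite take_cat size_nseq; case: ltnP => ij.
      rewrite take_nseq ?(ltnW ij) // count_nseq mul1n.
      by apply: leq_trans (count_size _ _) _; rewrite size_take; case: ltnP; lia.
    have := dom i.+1; rewrite vE take_cat size_nseq ltnNge (leq_trans ij) //=.
    by rewrite subSn //= !count_cat /=; lia.
Qed.

(** * One step of TASEP with a coin at every position, read only at the [true] of a corner *)

Fixpoint flip_corners (w l : seq bool) : seq bool :=
  match w, l with
  | true :: false :: w', c :: _ :: l' => ~~ c :: c :: flip_corners w' l'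
  | a :: w', _ :: l' => a :: flip_corners w' l'
  | _, _ => w
  end.

Lemma flip_corners_true w c l : head true w ->
  flip_corners (true :: w) (c :: l) = true :: flip_corners w l.
Proof. by case: w => [|[]]. Qed.

(* [coin_avg d G] averages [G] over independent coins: those allowed by the
   mask [d] show [true] with probability [1 - q ^+ 2], the others never do. *)
Fixpoint coin_avg (d : seq bool) (G : seq bool -> R) : R :=
  if d is c :: d' then
    let F := coin_avg d' (fun l => G (false :: l)) in
    if c then (1 - q ^+ 2) * coin_avg d' (fun l => G (true :: l)) + q ^+ 2 * F
    else F
  else G [::].

Lemma coin_avg_true d G : coin_avg (true :: d) G =
  (1 - q ^+ 2) * coin_avg d (fun l => G (true :: l))
  + q ^+ 2 * coin_avg d (fun l => G (false :: l)).
Proof. by []. Qed.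

Lemma eq_coin_avg d G H : G =1 H -> coin_avg d G = coin_avg d H.
Proof.
elim: d G H => [|c d IH] G H GH /=; first exact: GH.
have E c' : coin_avg d (fun l => G (c' :: l)) = coin_avg d (fun l => H (c' :: l)).
  by apply: IH => l; apply: GH.
by rewrite !E.
Qed.

Lemma coin_avg_geo N d (G : nat -> seq bool -> R) :
  coin_avg d (fun l => geo N (G ^~ l)) = geo N (fun i => coin_avg d (G i)).
Proof.
elim: d G => [//|c d IH] G /=.
rewrite (IH (fun i l => G i (false :: l))) (IH (fun i l => G i (true :: l))).
case: c => //; rewrite /geo !big_distrr -big_split /=.
by apply: eq_bigr => i _; ring.
Qed.

Lemma coin_avg_cons c d G H : (forall c' l, G (c' :: l) = H l) ->
  coin_avg (c :: d) G = coin_avg d H.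
Proof.
move=> GH /=.
have E c' : coin_avg d (fun l => G (c' :: l)) = coin_avg d H := eq_coin_avg d (GH c').
rewrite !E.
by case: c => //; ring.
Qed.

Let q_ge0 : 0 <= q. Proof. exact: ltW. Qed.
Let q2_ge0 : 0 <= q ^+ 2. Proof. exact: sqr_ge0. Qed.
Let p_ge0 : 0 <= 1 - q ^+ 2.
Proof. by rewrite subr_ge0 exprn_ile1 // ltW. Qed.

(* Where a flip creates a new corner, the new value of the walk is at most
   [x^-1] times its value at the flipped corner: each step costs a factor [x]. *)
Lemma potential_step N w d b r m : size d = size w ->
  (forall i, nth false w i -> ~~ nth true w i.+1 -> nth false d i) ->
  0 <= r -> 0 <= m ->
  coin_avg d (fun l => potential N (flip_corners w l) b r m)
  <= potential N.+1 w false (r / x)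
       (if b && ~~ head true w then Num.max m r else m).
Proof.
have [k] := ubnP (size w); elim: k w d b r m => // k IH w d b r m.
case: w => [|[] w] wk.
- by case: d => //= _ _ _ _; rewrite andbF.
- case: d => [//|c d] [sz] cov r0 m0; case: (boolP (head true w)) => hw.
    rewrite (@coin_avg_cons _ _ _
        (fun l => potential N (true :: flip_corners w l) b r m)) => [|c' l]; last first.
      by rewrite flip_corners_true.
    rewrite /= andbF coin_avg_geo; apply: le_trans (geo_leS _ _); last first.
      by move=> i; apply: potential_ge0.
    apply: geo_le => i; apply: le_trans (IH w d _ _ _ _ sz _ _ _) _ => //=.
    - by move=> j; apply: (cov j.+1).
    - by rewrite mulr_ge0 // ltW.
    - by rewrite hw /= potential_flag_irrel // [r / x * _]mulrAC.
  case: w hw wk sz cov => [|[] w] // _ wk; case: d => [//|c2 d] [sz] cov.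
  have -> : c by exact: (cov 0%N).
  rewrite [head _ _]/= andbF coin_avg_true.
  have step b' r' m' : 0 <= r' -> 0 <= m' ->
      coin_avg d (fun l => potential N (flip_corners w l) b' r' m')
      <= potential N.+1 w false (r' / x)
           (if b' && ~~ head true w then Num.max m' r' else m').
    by apply: IH => //; [exact: ltnW | move=> i; apply: (cov i.+2)].
  (* This is the right-hand side given the variables [i] and [j] of the two corner letters. In
     [geo_burke] the kept corner is matched with [F i.+1 j.+1], the flipped one with the positive
     parts of [i - j] and [j - i]. *)
  pose F i j := potential N.+1 w false (r / x * x ^+ i.+1 / x ^+ j.+1)
                  (Num.max m (r / x * x ^+ i.+1)).
  have F0 i j : 0 <= F i j by apply: potential_ge0; rewrite le_max m0.
  apply: le_trans (geo_burke N F0).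
  have rx i : 0 <= r * x ^+ i by rewrite mulr_ge0 // ltW.
  rewrite addrC; apply: lerD; apply: ler_wpM2l => //.
    rewrite (@coin_avg_cons _ _ _
      (fun l => potential N (true :: false :: flip_corners w l) b r m)) //.
    rewrite /= coin_avg_geo; apply: geo_le => i; rewrite coin_avg_geo; apply: geo_le => j.
    apply: le_trans (step _ _ _ _ _) _; first by rewrite divr_ge0 // ltW.
      by rewrite le_max m0.
    rewrite /F /= [x ^+ i.+2]exprS [x ^+ j.+2]exprS.
    have -> : r / x * (x * x ^+ i.+1) = r * x ^+ i.+1 by field.
    have -> // : r * x ^+ i.+1 / (x * x ^+ j.+1) = r * x ^+ i.+1 / x ^+ j.+1 / x.
    by field; rewrite !gt_eqF.
  rewrite (@coin_avg_cons _ _ _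
    (fun l => potential N (false :: true :: flip_corners w l) b r m)) //.
  rewrite [X in _ <= X]geo_swap /= coin_avg_geo.
  apply: geo_le => j; rewrite coin_avg_geo; apply: geo_le => i.
  (* After a flip the walk depends on [i] and [j] only through their signed difference. *)
  have r'E : r / x ^+ j.+1 * x ^+ i.+1 = r * x ^+ (i - j) / x ^+ (j - i).
    have xij : x ^+ i * x ^+ (j - i) = x ^+ (i - j) * x ^+ j.
      by rewrite -!exprD; congr (_ ^+ _); lia.
    have -> : r * x ^+ (i - j) / x ^+ (j - i)
        = r * (x ^+ (i - j) * x ^+ j) / x ^+ (j - i) / x ^+ j.
      by field; rewrite !gt_eqF.
    by rewrite -xij !exprS; field; rewrite xn0 !gt_eqF.
  apply: le_trans (step _ _ _ _ _) _.
  - by rewrite r'E divr_ge0 // ltW.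
  - by case: b; rewrite // le_max m0.
  have -> : F (i - j)%N (j - i)%N =
      potential N.+1 w false (r / x ^+ j.+1 * x ^+ i.+1 / x)
        (Num.max m (r * x ^+ (i - j))).
    rewrite /F r'E !exprS; congr potential; last congr Num.max; field; rewrite ?xn0 ?gt_eqF //.
  (* A flip may create a corner before the new [false] or after the new [true]. Both values are at
     most the one recorded at the old corner on the right-hand side. *)
  have rle : r <= r * x ^+ (i - j) by rewrite ler_peMr.
  have r'le : r / x ^+ j.+1 * x ^+ i.+1 <= r * x ^+ (i - j).
    by rewrite r'E ler_pdivrMr // ler_peMr.
  apply: potential_le.
  by case: b; case: ifP => _; rewrite ?ge_max !le_max ?lexx ?rle ?r'le ?orbT.
- case: d => [//|c d] [sz] cov r0 m0.
  rewrite (@coin_avg_cons _ _ _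
        (fun l => potential N (false :: flip_corners w l) b r m)) //.
  rewrite /= coin_avg_geo andbT; apply: le_trans (geo_leS _ _); last first.
    by move=> i; apply: potential_ge0; case: b; rewrite // le_max m0.
  apply: geo_le => i; apply: le_trans (IH w d _ _ _ _ sz _ _ _) _ => //=.
  - by move=> j; apply: (cov j.+1).
  - by rewrite divr_ge0 // ltW.
  - by case: b; rewrite // le_max m0.
  - by rewrite [r / x / _]mulrAC.
Qed.

(** * Potential of the initial word and of unsorted words *)

Lemma geo_const N c : geo N (fun=> c) = (1 - q ^+ N) * c.
Proof. by rewrite -geo1 -geoMr; apply: eq_geo => i; rewrite mul1r. Qed.

Let mass_le1 N : 1 - q ^+ N <= 1.
Proof. by rewrite gerBl exprn_ge0. Qed.
Let mass_ge0 N : 0 <= 1 - q ^+ N.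
Proof. by rewrite subr_ge0 exprn_ile1 // ltW. Qed.

Lemma potential_nseq_false N c b r m : 0 <= r -> 0 <= m ->
  potential N (nseq c false) b r m <= Num.max m r.
Proof.
elim: c b r m => [|c IH] b r m r0 m0 /=; first by rewrite le_max lexx.
apply: (@le_trans _ _ (geo N (fun=> Num.max m r))).
  apply: geo_le => j; apply: le_trans (IH _ _ _ _ _) _.
  - by rewrite divr_ge0 // ltW.
  - by case: b; rewrite // le_max m0.
  have rj : r / x ^+ j.+1 <= r by rewrite ler_pdivrMr // ler_peMr.
  by case: b; rewrite ?ge_max !le_max ?lexx ?rj ?orbT.
by rewrite geo_const ler_piMl // le_max m0.
Qed.

(** The walk peaks after the last of the initial letters [true], where it is [r] times [a]
    independent factors of mean at most [A]; along the letters [false] it only falls. *)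
Lemma potential_decreasing N a c b r A : geo N (fun i => x ^+ i.+1) <= A ->
  0 <= r -> potential N (nseq a true ++ nseq c false) b r 0 <= r * A ^+ a.
Proof.
move=> hA; have A0 : 0 <= A.
  by apply: le_trans hA; apply: geo_ge0 => i; apply: ltW.
elim: a b r => [|a IH] b r r0 /=.
  by rewrite expr0 mulr1; apply: le_trans (potential_nseq_false _ _ _ _ _) _ => //;
    rewrite ge_max lexx r0.
apply: (@le_trans _ _ (geo N (fun i => x ^+ i.+1 * (r * A ^+ a)))).
  apply: geo_le => i; apply: le_trans (IH _ _ _) _; first by rewrite mulr_ge0 // ltW.
  by rewrite mulrCA mulrA.
rewrite geoMr exprS [leRHS]mulrCA; apply: ler_wpM2r => //.
by rewrite mulr_ge0 // exprn_ge0.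
Qed.

Fixpoint unsorted (b : bool) (w : seq bool) : bool :=
  match w with
  | [::] => false
  | true :: w' => unsorted true w'
  | false :: w' => b || unsorted false w'
  end.

Lemma unsorted_corner b w i :
  nth false w i -> ~~ nth true w i.+1 -> unsorted b w.
Proof.
elim: w b i => [|[] w IH] b [|i] //=; first by case: w {IH} => [|[]].
- exact: IH.
- by move=> h1 h2; rewrite (IH false i h1 h2) orbT.
Qed.

Lemma potential_ge_mass N w b r m : 0 <= m ->
  m * (1 - q ^+ N) ^+ size w <= potential N w b r m.
Proof.
elim: w b r m => [|a w IH] b r m m0 /=; first by rewrite mulr1.
have -> : m * (1 - q ^+ N) ^+ (size w).+1 =
    geo N (fun=> m * (1 - q ^+ N) ^+ size w) by rewrite geo_const exprS mulrCA.
case: a; apply: geo_le => i; first exact: IH.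
have mm : m <= if b then Num.max m r else m by case: b; rewrite // le_max lexx.
by apply: le_trans (IH _ _ _ _) _ => //; apply: potential_le.
Qed.

(** The value at the first corner suffices. Before it, each [true] is bounded below by its mass [s]
    and each [false] contributes the mean [B]; from the corner on, a letter costs only the mass [s],
    which is at least [B]. *)
Lemma potential_unsorted N w b r m : unsorted b w -> 0 <= r -> 0 <= m ->
  r * (geo N (fun j => (x ^+ j.+1)^-1) ^+ count negb w
       * (1 - q ^+ N) ^+ count id w)
  <= potential N w b r m.
Proof.
set B := geo N _; set s := 1 - q ^+ N.
have s0 : 0 <= s by exact: mass_ge0.
have B0 : 0 <= B by apply: geo_ge0 => j; rewrite invr_ge0 ltW.
have Bs : B <= s.
  by rewrite /s -geo1; apply: geo_le => j; rewrite invf_le1.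
elim: w b r m => [//|[] w IH] b r m /=; rewrite add0n add1n => uw r0 m0.
  set C := B ^+ _ * _.
  apply: (@le_trans _ _ (geo N (fun=> r * (B ^+ count negb w * s ^+ count id w)))).
    by rewrite geo_const -/s /C exprS le_eqVlt; apply/orP; left; apply/eqP; ring.
  apply: geo_le => i; apply: le_trans (IH _ _ _ uw _ m0); last by rewrite mulr_ge0 // ltW.
  by rewrite ler_wpM2r ?ler_peMr // mulr_ge0 // exprn_ge0.
case: b uw => /= uw.
  apply: (@le_trans _ _ (geo N (fun=> r * s ^+ size w))).
    rewrite geo_const -/s [leRHS]mulrCA; apply: ler_wpM2l => //.
    rewrite exprS -mulrA; apply: ler_pM => //.
      by rewrite mulr_ge0 // exprn_ge0.
    rewrite -(count_predC id w) addnC exprD; apply: ler_wpM2r; first exact: exprn_ge0.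
    by apply: lerXn2r.
  apply: geo_le => j.
  apply: le_trans (potential_ge_mass _ _ _ _ _); last by rewrite le_max m0.
  by apply: ler_wpM2r; rewrite ?exprn_ge0 // le_max lexx orbT.
apply: (@le_trans _ _ (geo N (fun j =>
    (x ^+ j.+1)^-1 * (r * (B ^+ count negb w * s ^+ count id w))))).
  by rewrite geoMr -/B exprS le_eqVlt; apply/orP; left; apply/eqP; ring.
apply: geo_le => j; apply: le_trans (IH _ _ _ uw _ m0); last by rewrite divr_ge0 // ltW.
by rewrite mulrA [_^-1 * r]mulrC.
Qed.

Lemma geo_expr N z : (1 - q * z) * geo N (fun i => z ^+ i.+1)
  = (1 - q) * z * (1 - (q * z) ^+ N).
Proof.
rewrite -[1 - (q * z) ^+ N]opprB subrX1.
rewrite -[- ((_ - 1) * _)]mulNr opprB [RHS]mulrCA.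
congr (_ * _); rewrite /geo big_distrr; apply: eq_bigr => i _ /=.
by rewrite exprMn exprS; ring.
Qed.

(** The bound is the untruncated mean [(1 - q) * x / (1 - q * x)], written to show its first-order
    term in [x - 1]. *)
Lemma geo_expr_le N : q * x < 1 ->
  geo N (fun i => x ^+ i.+1) <= 1 + (x - 1) / (1 - q * x).
Proof.
move=> qx; have qx0 : 0 < 1 - q * x by rewrite subr_gt0.
have -> : 1 + (x - 1) / (1 - q * x) = (1 - q) * x / (1 - q * x).
  by field; rewrite gt_eqF.
rewrite ler_pdivlMr // mulrC geo_expr ler_piMr //.
  by rewrite mulr_ge0 // ?subr_ge0 ltW.
by rewrite gerBl exprn_ge0 // mulr_ge0 // ltW.
Qed.

(** The untruncated mean is [(1 - q) / (x - q)]; truncation costs at most the factor [1 - q ^+ N]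
    because [q / x <= q]. *)
Lemma geo_exprV_ge N :
  (1 - q ^+ N) / (1 + (x - 1) / (1 - q)) <= geo N (fun i => (x ^+ i.+1)^-1).
Proof.
have q1 : 0 < 1 - q by rewrite subr_gt0.
have xq : 0 < x - q by rewrite subr_gt0 (lt_le_trans q_lt1).
have xq' : 0 < 1 - q * x^-1 by rewrite subr_gt0 ltr_pdivrMr // mul1r -subr_gt0.
have -> : 1 + (x - 1) / (1 - q) = (x - q) / (1 - q) by field; rewrite gt_eqF.
rewrite -(ler_pM2l xq').
have -> : geo N (fun i => (x ^+ i.+1)^-1) = geo N (fun i => x^-1 ^+ i.+1).
  by apply: eq_geo => i; rewrite exprVn.
rewrite geo_expr.
have -> : (1 - q / x) * ((1 - q ^+ N) / ((x - q) / (1 - q)))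
    = (1 - q) / x * (1 - q ^+ N).
  by field; rewrite xn0 !gt_eqF.
apply: ler_wpM2l; first by rewrite divr_ge0 // ltW.
rewrite lerD2l lerN2 exprMn ler_piMr ?exprn_ge0 //.
by rewrite exprn_ile1 ?invr_ge0 ?invf_le1 // ltW.
Qed.

End GeometricPotential.

(** * Ungar moves on 0/1 words *)

(** A word is read corner by corner. The default [true] of [head] makes a final [true] a letter
    outside any corner. *)
Lemma flip_corners_ind (P : seq bool -> seq bool -> Prop) :
  P [::] [::] ->
  (forall c c' w l, P w l -> P (true :: false :: w) (c :: c' :: l)) ->
  (forall a c w l, ~~ a || head true w -> P w l -> P (a :: w) (c :: l)) ->
  forall w l, size l = size w -> P w l.
Proof.
move=> P0 P2 P1 w l; have [k] := ubnP (size w); elim: k w l => // k IH [|a w] [|c l] //.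
rewrite /= ltnS => wk [sz]; case: (boolP (~~ a || head true w)) => aw.
  by apply: P1 => //; apply: IH.
move: aw; rewrite negb_or negbK => /andP[]; case: a => // _.
case: w wk sz => [|[] w] //= wk; case: l => [//|c' l] [sz] _.
by apply: P2; apply: IH => //; apply: ltnW.
Qed.

Lemma flip_corners_cons a c w l : ~~ a || head true w ->
  flip_corners (a :: w) (c :: l) = a :: flip_corners w l.
Proof. by case: a => // hw; rewrite flip_corners_true. Qed.

Lemma size_flip_corners w l : size l = size w -> size (flip_corners w l) = size w.
Proof.
move: w l; apply: flip_corners_ind => // [c c' w l /= -> //|a c w l aw IH].
by rewrite flip_corners_cons //= IH.
Qed.

Lemma count_flip_corners w l : size l = size w ->
  count id (flip_corners w l) = count id w.
Proof.
move: w l; apply: flip_corners_ind => // [c c' w l /= ->|a c w l aw IH].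
  by case: c.
by rewrite flip_corners_cons //= IH.
Qed.

(** A flip preserves the count of every prefix except the one that cuts through the flipped
    corner. *)
Lemma count_take_flip_corners w l i : size l = size w ->
  (count id (take i w) <= count id (take i (flip_corners w l))
    + [&& 0 < i, nth false w i.-1, ~~ nth true w i & nth false l i.-1])%N.
Proof.
move=> sz; move: w l sz i; apply: flip_corners_ind => //.
  move=> c c' w l IH [|[|i]] //=; first by case: c; rewrite ?take0.
  by move: (IH i); case: i => [|i] /=; rewrite ?take0 /=; case: c => /=; lia.
move=> a c w l aw IH [|i]; rewrite flip_corners_cons //=.
by move: (IH i); case: i => [|i] /=; rewrite ?take0 /=; lia.
Qed.

Lemma inTE n (T : {set 'I_n}) (i : 'I_n) : inT T i = (i \in T).
Proof.
apply/existsP/idP => [[j /andP[jT /eqP/val_inj <-]] //|iT].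
by exists i; rewrite iT eqxx.
Qed.

Definition entry n (s : {perm 'I_n}) (j : nat) : nat :=
  if insub j is Some i then val (s i) else n.

Lemma entryE n (s : {perm 'I_n}) (i : 'I_n) : entry s i = s i.
Proof. by rewrite /entry valK. Qed.

Definition word n (k : nat) (s : {perm 'I_n}) : seq bool :=
  mkseq (fun j => k <= entry s j)%N n.

Lemma DesP n (s : {perm 'I_n}) (i : 'I_n) :
  (i \in Des s) = ((i.+1 < n) && (entry s i.+1 < entry s i))%N.
Proof.
rewrite inE; case: ltnP => //= lt_in; rewrite entryE /ord_succ.
by rewrite /insubd /entry insubT.
Qed.

Section UngarBlocks.
Variables (n : nat) (s : {perm 'I_n}) (T : {set 'I_n}).
Hypothesis TDes : T \subset Des s.

Lemma inT_descent k : inT T k -> (k.+1 < n)%N /\ (entry s k.+1 < entry s k)%N.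
Proof.
case/existsP => i /andP[/(fintype.subsetP TDes)].
by rewrite DesP => /andP[lt_in lt_s] /eqP <-.
Qed.

Lemma runRP j : (j < n)%N ->
  [/\ (j + runR T j < n)%N, ~~ inT T (j + runR T j) &
      forall m, (j <= m < j + runR T j)%N -> inT T m].
Proof.
move=> jn; rewrite /runR; set P := fun m => _.
have hasP : has P (iota 0 n).
  (* Position [n.-1] is never a descent, so a run to the right stops there at the latest. *)
  apply/hasP; exists (n.-1 - j)%N; first by rewrite mem_iota; lia.
  by apply/negP => /inT_descent[]; lia.
have lt_find : (find P (iota 0 n) < n)%N by rewrite -[ltnRHS](size_iota 0) -has_find.
have Pfind : P (find P (iota 0 n)).
  by have := nth_find 0%N hasP; rewrite nth_iota.
have Pbefore m : (j <= m < j + find P (iota 0 n))%N -> inT T m.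
  move=> /andP[jm mj]; have mf : (m - j < find P (iota 0 n))%N by lia.
  have := before_find 0%N mf; rewrite nth_iota ?(ltn_trans mf) //.
  by rewrite /P add0n subnKC // => /negbFE.
split=> //; rewrite ltnNge; apply/negP => nle.
have /inT_descent[] : inT T n.-1 by apply: Pbefore; lia.
by lia.
Qed.

Lemma runLP j : (j < n)%N ->
  [/\ (runL T j <= j)%N, (runL T j == j) || ~~ inT T (j - runL T j).-1 &
      forall m, (j - runL T j <= m < j)%N -> inT T m].
Proof.
move=> jn; rewrite /runL; set P := fun m => _.
have hasP : has P (iota 0 n).
  by apply/hasP; exists j; rewrite ?mem_iota // /P leqnn.
have lt_find : (find P (iota 0 n) < n)%N by rewrite -[ltnRHS](size_iota 0) -has_find.
have Pfind : P (find P (iota 0 n)).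
  by have := nth_find 0%N hasP; rewrite nth_iota.
have Pbefore m : (m < find P (iota 0 n))%N -> (m < j)%N /\ inT T (j - m.+1).
  move=> mf; have := before_find 0%N mf; rewrite nth_iota ?(ltn_trans mf lt_find) //.
  by rewrite /P add0n => /norP[]; rewrite -ltnNge negbK.
have le_find : (find P (iota 0 n) <= j)%N.
  by rewrite leqNgt; apply/negP => lt_j; have [] := Pbefore _ lt_j; rewrite ltnn.
split=> //.
  case/orP: Pfind => [le_j|]; first by rewrite eqn_leq le_find le_j.
  by rewrite -subnS => ->; rewrite orbT.
move=> m mj; have [|_] := Pbefore (j - m.+1)%N; first by lia.
by have -> : (j - (j - m.+1).+1 = m)%N by lia.
Qed.

Definition block_rev (j : nat) : nat := (j + runR T j - runL T j)%N.

(** All positions of a maximal block share its ends [l] and [r], so the index map is the reflection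
    of the interval. This makes [block_rev] an involution. *)
Lemma blockP j : (j < n)%N -> exists l r,
  [/\ (l <= j <= r)%N, (r < n)%N, forall m, (l <= m < r)%N -> inT T m,
      ~~ inT T r /\ ((l == 0)%N || ~~ inT T l.-1) &
      forall j', (l <= j' <= r)%N -> block_rev j' = (l + r - j')%N].
Proof.
move=> jn; have [Rn Rr Rin] := runRP jn; have [Lj Ll Lin] := runLP jn.
set l := (j - runL T j)%N in Ll Lin *; set r := (j + runR T j)%N in Rn Rr Rin *.
have lr m : (l <= m < r)%N -> inT T m.
  by move=> mlr; case: (ltnP m j) => mj; [apply: Lin|apply: Rin]; lia.
exists l, r; split=> //; first lia.
  by split=> //; case/orP: Ll => [|->]; rewrite ?orbT // /l => /eqP ->; rewrite subnn.
have {}Ll : l = 0%N \/ ~~ inT T l.-1.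
  by case/orP: Ll => [/eqP|]; [rewrite /l => ->; left; lia|right].
move=> j' j'lr; rewrite /block_rev.
have [//|Rn' Rr' Rin'] := @runRP j'; first lia.
have [//|Lj' Ll' Lin'] := @runLP j'; first lia.
have -> : runR T j' = (r - j')%N.
  case: (ltngtP (j' + runR T j') r) => [lt|gt|]; last lia.
    by rewrite lr // in Rr'; lia.
  by rewrite Rin' // in Rr; lia.
have -> : runL T j' = (j' - l)%N; last lia.
case: (ltngtP (j' - runL T j') l) => [lt|gt|]; last lia.
  by case: Ll => [|]; [lia|rewrite Lin' //; lia].
case/orP: Ll' => [|]; first lia.
by rewrite lr //; lia.
Qed.

Lemma block_rev_lt j : (j < n)%N -> (block_rev j < n)%N.
Proof. by move=> jn; have [l [r [lr rn _ _ ->]]] := blockP jn; lia. Qed.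

Lemma block_revK j : (j < n)%N -> block_rev (block_rev j) = j.
Proof. by move=> jn; have [l [r [lr rn _ _ E]]] := blockP jn; rewrite !E; lia. Qed.

(** Since [block_rev] is an involution, [ungar_fun] is injective and the default of [insubd] in
    [ungar] is never taken. *)
Lemma entry_ungar j : (j < n)%N -> entry (ungar s T) j = entry s (block_rev j).
Proof.
have revE (i : 'I_n) : ungar_fun s T i = s (Ordinal (block_rev_lt (ltn_ord i))).
  rewrite ffunE; congr (s _); apply: val_inj; rewrite val_insubd.
  by rewrite -/(block_rev i) block_rev_lt.
have inj : injectiveb (ungar_fun s T).
  apply/injectiveP => i i'; rewrite !revE => /perm_inj /(congr1 val) /= E.
  by apply: val_inj; rewrite /= -(block_revK (ltn_ord i)) E block_revK.
move=> jn; rewrite -[j]/(val (Ordinal jn)) entryE /ungar -pvalE.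
by rewrite [pval _]insubdK // revE -entryE.
Qed.

Local Notation cnt f i := (count f (iota 0 i)).

Let cntS (f : nat -> bool) i : cnt f i.+1 = (cnt f i + f i)%N.
Proof. by rewrite -addn1 iotaD count_cat /= add0n addn0. Qed.

Let cnt_le (f : nat -> bool) l i : (l <= i)%N ->
  (cnt f l <= cnt f i <= cnt f l + (i - l))%N.
Proof.
elim: i => [|i IH]; first by rewrite leqn0 => /eqP ->; lia.
rewrite leq_eqVlt => /predU1P[->|li]; first lia.
by have := IH li; rewrite cntS; case: (f i); lia.
Qed.

Let cnt_true (f : nat -> bool) l i : (l <= i)%N ->
  (forall j, (l <= j < i)%N -> f j) -> cnt f i = (cnt f l + (i - l))%N.
Proof.
elim: i => [|i IH]; first by rewrite leqn0 => /eqP ->; lia.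
rewrite leq_eqVlt => /predU1P[->|li] fT; first lia.
rewrite cntS IH // ?fT; first lia.
  by lia.
by move=> j jli; apply: fT; lia.
Qed.

Let cnt_false (f : nat -> bool) l i : (l <= i)%N ->
  (forall j, (l <= j < i)%N -> ~~ f j) -> cnt f i = cnt f l.
Proof.
elim: i => [|i IH]; first by rewrite leqn0 => /eqP ->.
rewrite leq_eqVlt => /predU1P[->//|li] fF.
rewrite cntS IH // ?(negbTE (fF i _)) ?addn0 //; first by lia.
by move=> j jli; apply: fF; lia.
Qed.

Let cnt_block (f : nat -> bool) i : (i <= n)%N -> (i == 0)%N || ~~ inT T i.-1 ->
  cnt (f \o block_rev) i = cnt f i.
Proof.
move=> i_n bd; rewrite -count_map.
suff /seq.permP -> : perm_eq (map block_rev (iota 0 i)) (iota 0 i) by [].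
have stable j : (j < i)%N -> (block_rev j < i)%N.
  move=> ji; have [|l [r [lr rn inlr _ revE]]] := @blockP j; first lia.
  rewrite revE //.
  case: (ltnP r i) => ri; first lia.
  by move: bd; rewrite inlr ?orbF; lia.
have revK : {in iota 0 i, cancel block_rev block_rev}.
  by move=> j; rewrite mem_iota => ji; apply: block_revK; lia.
apply: uniq_perm; rewrite ?iota_uniq ?map_inj_in_uniq ?iota_uniq //.
  exact: can_in_inj revK.
move=> j; apply/mapP/idP => [[j' ji ->]|ji].
  by move: ji; rewrite !mem_iota /= add0n; apply: stable.
exists (block_rev j); last by rewrite revK.
by move: ji; rewrite !mem_iota /= add0n; apply: stable.
Qed.

(** At a block boundary [block_rev] permutes the prefix. Inside a block the entries decrease, so its
    bits are ones followed by zeros, and reversal puts the zeros first: no prefix gains a one, and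
    one that cuts at the corner loses at least one. *)
Lemma count_block_rev k i : (i <= n)%N ->
  (cnt ((fun j => k <= entry s j) \o block_rev) i
   + [&& 0 < i, k <= entry s i.-1, ~~ (k <= entry s i) & inT T i.-1]
   <= cnt (fun j => k <= entry s j) i)%N.
Proof.
move=> i_n; set f := fun j => (k <= entry s j)%N.
rewrite -/(f i.-1) -/(f i); case: (boolP ((i == 0)%N || ~~ inT T i.-1)) => bd.
  rewrite cnt_block //; have -> : [&& 0 < i, f i.-1, ~~ f i & inT T i.-1]%N = false.
    by case/orP: bd => [/eqP -> //|/negbTE ->]; rewrite !andbF.
  by rewrite addn0.
move: bd; rewrite negb_or negbK => /andP[i0 iT]; rewrite iT andbT.
have [|l [r [lr rn inlr [rT lT] revE]]] := @blockP i.-1; first lia.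
have ir : (i <= r)%N.
  rewrite leqNgt; apply/negP => ri; have rE : r = i.-1 by lia.
  by rewrite rE iT in rT.
have decr a b : (l <= a)%N -> (a <= b)%N -> (b <= r)%N -> (entry s b <= entry s a)%N.
  move=> la; elim: b => [|b IH]; first by rewrite leqn0 => /eqP ->.
  rewrite leq_eqVlt => /predU1P[-> //|ab] br.
  apply: leq_trans (IH _ _); rewrite // ?(ltnW br) //.
  by have [|_ /ltnW] := @inT_descent b; [apply: inlr; lia|].
have gl : cnt (f \o block_rev) l = cnt f l by apply: cnt_block => //; lia.
have gr : cnt (f \o block_rev) r.+1 = cnt f r.+1 by apply: cnt_block.
have li : (l < i)%N by lia.
(* If the last bit of the prefix is zero, so are the later ones in the block, and the prefix already
   holds all the ones of the block. *)
case: (boolP (f i.-1)) => fi1 /=; last first.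
  have := @cnt_false f i r.+1; have := @cnt_le (f \o block_rev) i r.+1.
  rewrite gr => H1 H2; rewrite andbF addn0 -H2; [lia|lia|].
  move=> j jr; move: fi1; rewrite /f -!ltnNge; apply: leq_ltn_trans.
  by apply: decr; lia.
rewrite lt0n i0 /= (@cnt_true f l i) ?(ltnW li) //; last first.
  by move=> j jl; apply: leq_trans fi1 _; apply: decr; lia.
case: (boolP (f i)) => fi /=.
  by rewrite addn0 -gl; have := @cnt_le (f \o block_rev) l i (ltnW li); lia.
have := @cnt_le (f \o block_rev) l.+1 i li; rewrite cntS gl.
(* The reversed block starts with the old entry at [r], which is at most the entry at [i] and hence
   below [k]. *)
have -> : (f \o block_rev) l = false; last by lia.
rewrite /= revE; last lia.
apply/negbTE; have -> : (l + r - l = r)%N by lia.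
by move: fi; rewrite /f -!ltnNge; apply: leq_ltn_trans; apply: decr; lia.
Qed.

Let count_take_mkseq (f : nat -> bool) i : (i <= n)%N ->
  count id (take i (mkseq f n)) = cnt f i.
Proof.
by move=> i_n; rewrite /mkseq -map_take take_iota (minn_idPl i_n) count_map.
Qed.

Lemma word_ungar k : word k (ungar s T) =
  mkseq ((fun j => k <= entry s j)%N \o block_rev) n.
Proof.
by apply/eq_in_map => j; rewrite mem_iota => jn; rewrite entry_ungar //=; lia.
Qed.

Lemma ungar_dominated k :
  let w := flip_corners (word k s) (mkseq (inT T) n) in
  [/\ size (word k (ungar s T)) = size w,
      count id (word k (ungar s T)) = count id w &
      forall i, (count id (take i (word k (ungar s T))) <= count id (take i w))%N].
Proof.
move=> w; have sz : size (mkseq (inT T) n) = size (word k s) by rewrite !size_mkseq.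
have szw : size w = n by rewrite /w size_flip_corners // size_mkseq.
have szu : size (word k (ungar s T)) = n by rewrite size_mkseq.
have ct : count id (word k (ungar s T)) = count id w.
  rewrite /w count_flip_corners // -(take_size (word k (ungar s T))) szu.
  rewrite -(take_size (word k s)) [size (word k s)]size_mkseq.
  rewrite word_ungar !count_take_mkseq //; apply: cnt_block => //.
  rewrite -implyNb; apply/implyP => n0.
  by apply/negP => /inT_descent[]; lia.
rewrite szu szw; split=> // i; case: (leqP i n) => i_n; last first.
  by rewrite !take_oversize ?szu ?szw ?ct // ltnW.
have := count_take_flip_corners i sz; rewrite -/w.
have := count_block_rev k i_n; rewrite -count_take_mkseq // -word_ungar.
rewrite -count_take_mkseq // -/(word k s).
have -> : [&& 0 < i, nth false (word k s) i.-1, ~~ nth true (word k s) i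
             & nth false (mkseq (inT T) n) i.-1]%N
    = [&& 0 < i, k <= entry s i.-1, ~~ (k <= entry s i) & inT T i.-1]%N.
  case: i i_n => // i i_n /=; rewrite /word.
  rewrite [nth false _ _]nth_mkseq // [nth false (mkseq (inT T) n) _]nth_mkseq //.
  (* Membership in [T] forces [i.+1 < n], so the default of [nth] is not reached. *)
  case: (boolP (inT T i)) => [/inT_descent[iT _]|_]; last by rewrite !andbF.
  by rewrite nth_mkseq.
by lia.
Qed.

End UngarBlocks.

(** * The Ungarian Markov chain *)

Lemma big_powersetU1 (R : realType) (I : finType) (i : I) (D : {set I})
    (F : {set I} -> R) : i \notin D ->
  \sum_(T in powerset (i |: D)) F T
  = \sum_(T in powerset D) F (i |: T) + \sum_(T in powerset D) F T.
Proof.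
move=> iD; rewrite (bigID (fun T : {set I} => i \in T)) /=; congr (_ + _).
  rewrite (reindex_onto (fun T => i |: T) (fun T => T :\ i)) /=; last first.
    by move=> T /andP[_ iT]; rewrite finset.setD1K.
  apply: eq_bigl => T; rewrite !powersetE finset.setU11 andbT.
  apply/andP/idP => [[sTD /eqP TE]|sTD].
    have iT : i \notin T by rewrite -TE finset.setD11.
    by rewrite -(finset.setU1K iT) finset.subDset.
  by rewrite finset.setUS //= finset.setU1K //; apply: contra iD; apply/fintype.subsetP.
apply: eq_bigl => T; rewrite !powersetE; apply/andP/idP => [[sTD iT]|sTD].
  apply/fintype.subsetP => j jT; move/fintype.subsetP/(_ j jT): sTD.
  by rewrite finset.in_setU1 => /predU1P[ji|//]; rewrite -ji jT in iT.
split; first exact: fintype.subset_trans sTD (finset.subsetUr _ _).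
by apply: contra iD; apply/fintype.subsetP.
Qed.

Section UngarChain.
Variables (R : realType) (p q : R).
Hypotheses (q_gt0 : 0 < q) (q_lt1 : q < 1) (pE : p = 1 - q ^+ 2).

Let p_ge0 : 0 <= p. Proof. by rewrite pE subr_ge0 exprn_ile1 // ltW. Qed.
Let p_le1 : 0 <= 1 - p. Proof. by rewrite pE opprB addrC subrK sqr_ge0. Qed.

Lemma sum_powerset_coin_avg n (D : {set 'I_n}) (G : seq bool -> R) :
  \sum_(T in powerset D) p ^+ #|T| * (1 - p) ^+ (#|D| - #|T|) * G (mkseq (inT T) n)
  = coin_avg q (mkseq (inT D) n) G.
Proof.
(* Induction on the number [m] of trailing positions; each step adds the coin at position [n - m.+1]
   in front, where [coin_avg] reads it. *)
pose Dk k := [set i in D | (k <= i)%N].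
suff H m G' : (m <= n)%N ->
    \sum_(T in powerset (Dk (n - m)%N))
      p ^+ #|T| * (1 - p) ^+ (#|Dk (n - m)%N| - #|T|) * G' (map (inT T) (iota (n - m) m))
    = coin_avg q (map (inT D) (iota (n - m) m)) G'.
  have := H n G (leqnn n); rewrite subnn.
  by have -> : Dk 0%N = D by apply/finset.setP => i; rewrite inE andbT.
elim: m G' => [|m IH] G' mn.
  rewrite subn0; have -> : Dk n = finset.set0.
    by apply/finset.setP => i; rewrite !inE leqNgt ltn_ord andbF.
  by rewrite powerset0 big_set1 /= cards0 !mulr1 mul1r.
have kn : (n - m.+1 < n)%N by lia.
have [k kE] : exists k : 'I_n, k = (n - m.+1)%N :> nat by exists (Ordinal kn).
have mk : (n - m = k.+1)%N by lia.
rewrite -kE [iota k m.+1]/= -mk.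
have kD' : k \notin Dk k.+1 by rewrite inE ltnn andbF.
have notT T : T \in powerset (Dk k.+1) -> k \notin T.
  by rewrite powersetE => /fintype.subsetP sT; apply: contra kD'; apply: sT.
have mapU T : map (inT (k |: T)) (iota (n - m) m) = map (inT T) (iota (n - m) m).
  apply/eq_in_map => j; rewrite mem_iota mk => jm.
  have jn : (j < n)%N by lia.
  rewrite -[j]/(val (Ordinal jn)) !inTE !inE -val_eqE /=.
  by case: eqP => // jE; lia.
have {}IH := IH _ (ltnW mn).
rewrite /=.
case: (boolP (inT D k)) => kD.
  have DkE : Dk k = k |: Dk k.+1.
    apply/finset.setP => i; rewrite !inE; case: eqVneq => [->|ik] /=.
      by rewrite -inTE kD leqnn.
    by congr (_ && _); move: ik; rewrite -val_eqE /=; lia.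
  rewrite DkE big_powersetU1 // -!IH mk !big_distrr; congr (_ + _).
    apply: eq_bigr => T TD; have kT := notT T TD.
    rewrite !cardsU1 kT kD' -mk mapU inTE finset.setU11 subSS -pE /=.
    by rewrite add1n exprS -!mulrA.
  apply: eq_bigr => T TD; have kT := notT T TD.
  have -> : inT T k = false by rewrite inTE (negbTE kT).
  have cT : (#|T| <= #|Dk k.+1|)%N by apply: subset_leq_card; rewrite -powersetE.
  have -> : q ^+ 2 = 1 - p by rewrite pE; ring.
  by rewrite cardsU1 kD' add1n subSn // exprS -mk /= [RHS]mulrA mulrCA.
have DkE : Dk k = Dk k.+1.
  apply/finset.setP => i; rewrite !inE; case: (eqVneq i k) => [->|ik].
    by rewrite -inTE (negbTE kD).
  by congr (_ && _); move: ik; rewrite -val_eqE /=; lia.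
rewrite DkE -IH mk; apply: eq_bigr => T TD.
by have -> : inT T k = false by rewrite inTE (negbTE (notT T TD)).
Qed.

Lemma sum_ungar_trans n (s : {perm 'I_n}) (h : {perm 'I_n} -> R) :
  \sum_s' ungar_trans p s s' * h s'
  = \sum_(T in powerset (Des s))
      p ^+ #|T| * (1 - p) ^+ (#|Des s| - #|T|) * h (ungar s T).
Proof.
rewrite [RHS](partition_big (ungar s) xpredT) //=; apply: eq_bigr => s' _.
by rewrite big_distrl; apply: eq_bigr => T /andP[_ /eqP ->].
Qed.

Lemma ungar_trans_ge0 n (s s' : {perm 'I_n}) : 0 <= ungar_trans p s s'.
Proof. by apply: sumr_ge0 => T _; rewrite mulr_ge0 // exprn_ge0. Qed.

Lemma sum_ungar_trans1 n (s : {perm 'I_n}) : \sum_s' ungar_trans p s s' = 1.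
Proof.
have := sum_ungar_trans s (fun=> 1); have := sum_powerset_coin_avg (Des s) (fun=> 1).
under [X in _ -> X = _ -> _]eq_bigr do rewrite mulr1.
move=> -> ->; elim: mkseq => //= c l ->; case: c => //; ring.
Qed.

Lemma alive_ge0 n t (s : {perm 'I_n}) : 0 <= alive n p t s.
Proof.
elim: t s => [|t IH] s; rewrite ffunE; case: ifP => // _.
by apply: sumr_ge0 => s' _; rewrite mulr_ge0 // ungar_trans_ge0.
Qed.

Lemma alive_id n t : alive n p t 1%g = 0.
Proof. by case: t => [|t]; rewrite ffunE eqxx ?andbF. Qed.

(** Mass that reaches the identity is dropped, hence an inequality. *)
Lemma alive_next_le n t (h : {perm 'I_n} -> R) : (forall s, 0 <= h s) ->
  \sum_s' alive n p t.+1 s' * h s'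
  <= \sum_s alive n p t s * \sum_s' ungar_trans p s s' * h s'.
Proof.
move=> h0; under [leRHS]eq_bigr do rewrite big_distrr.
rewrite exchange_big; apply: ler_sum => s' _; rewrite ffunE.
rewrite [leRHS](_ : _ = (\sum_s alive n p t s * ungar_trans p s s') * h s').
  apply: ler_wpM2r => //; case: ifP => // _.
  by apply: sumr_ge0 => s _; rewrite mulr_ge0 ?alive_ge0 ?ungar_trans_ge0.
by rewrite big_distrl; apply: eq_bigr => s _ /=; rewrite mulrA.
Qed.

Lemma alive_sum_le1 n t : \sum_s alive n p t s <= 1.
Proof.
elim: t => [|t IH].
  rewrite (bigD1 (perm_dec n)) //= big1 ?addr0 => [|s /negbTE sd].
    by rewrite ffunE; case: ifP.
  by rewrite ffunE sd.
apply: le_trans IH; have := @alive_next_le n t (fun=> 1) (fun=> ler01).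
under eq_bigr do rewrite mulr1; move=> /le_trans -> //.
apply: ler_sum => s _; under eq_bigr do rewrite mulr1.
by rewrite sum_ungar_trans1 mulr1.
Qed.

Variable x : R.
Hypothesis x_ge1 : 1 <= x.

(** For each [T], dominance replaces the Ungar move by corner flips with coins [inT T]; averaging
    over [T] is then a TASEP step. The descent set covers every corner of every word, as the mask
    must. *)
Lemma ungar_potential_step n N k (s : {perm 'I_n}) r : 0 <= r ->
  \sum_s' ungar_trans p s s' * potential q x N (word k s') false r 0
  <= potential q x N.+1 (word k s) false (r / x) 0.
Proof.
move=> r0; rewrite sum_ungar_trans.
have := @potential_step _ _ _ q_gt0 q_lt1 x_ge1 N (word k s)
  (mkseq (inT (Des s)) n) false r 0.
rewrite -(sum_powerset_coin_avg (Des s)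
  (fun l => potential q x N (flip_corners (word k s) l) false r 0)) /= => step.
apply: le_trans (step _ _ _ _) => //; last 2 first.
- by rewrite !size_mkseq.
- move=> i; case: (ltnP i n) => i_n; last by rewrite nth_default ?size_mkseq.
  case: (ltnP i.+1 n) => i1n; last by rewrite [nth true _ _]nth_default ?size_mkseq.
  rewrite !nth_mkseq // -ltnNge => h1 h2; rewrite -[i]/(val (Ordinal i_n)) inTE DesP.
  by rewrite i1n /= (leq_trans h2 h1).
apply: ler_sum => T; rewrite powersetE => TD.
apply: ler_wpM2l; first by rewrite mulr_ge0 // exprn_ge0.
have [sz ct dom] := ungar_dominated TD k.
exact: potential_dominance.
Qed.

Lemma alive_potential n N k t r : 0 <= r ->
  \sum_s alive n p t s * potential q x N (word k s) false r 0
  <= potential q x (N + t) (word k (perm_dec n)) false (r / x ^+ t) 0.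
Proof.
elim: t N r => [|t IH] N r r0.
  rewrite addn0 expr0 divr1 (bigD1 (perm_dec n)) //= big1 ?addr0 => [|s /negbTE sd].
    rewrite ffunE; case: ifP => _; rewrite ?mul1r ?mul0r //.
    exact: potential_ge0.
  by rewrite ffunE sd mul0r.
apply: le_trans (alive_next_le _ _) _ => [s|]; first exact: potential_ge0.
rewrite addnS -addSn exprS invfM mulrA.
apply: le_trans (IH _ _ _); last by rewrite divr_ge0 // (le_trans ler01).
apply: ler_sum => s _; apply: ler_wpM2l; first exact: alive_ge0.
exact: ungar_potential_step.
Qed.

End UngarChain.

(** * From words back to permutations *)

Lemma word_dec n k : (k <= n)%N ->
  word k (perm_dec n) = nseq (n - k) true ++ nseq k false.
Proof.
move=> kn; apply: (@eq_from_nth _ false).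
  by rewrite size_mkseq size_cat !size_nseq subnK.
move=> j; rewrite size_mkseq => jn; rewrite nth_mkseq // nth_cat size_nseq.
rewrite -[j]/(val (Ordinal jn)) entryE permE /= !nth_nseq.
by case: ltnP => jk; [lia|case: ifP => _; lia].
Qed.

Lemma count_word n k (s : {perm 'I_n}) : (k <= n)%N ->
  count id (word k s) = (n - k)%N.
Proof.
move=> kn.
have E (s' : {perm 'I_n}) : count id (word k s') = (\sum_(i < n) (k <= i))%N.
  rewrite /word count_map -sum1_count big_mkcond /=.
  have -> : iota 0 n = index_iota 0 n by rewrite /index_iota subn0.
  rewrite big_mkord.
  rewrite [RHS](reindex_inj (@perm_inj _ s')) /=.
  by apply: eq_bigr => i _; rewrite entryE; case: leqP.
rewrite E -(E (perm_dec n)) word_dec // count_cat !count_nseq; lia.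
Qed.

Lemma count_negb_word n k (s : {perm 'I_n}) : (k <= n)%N ->
  count negb (word k s) = k.
Proof.
move=> kn; have := count_predC id (word k s).
rewrite count_word // size_mkseq -[count (predC _) _]/(count negb _); lia.
Qed.

Lemma unsorted_word n (s : {perm 'I_n}) : s != 1%g ->
  exists k : 'I_n, unsorted false (word k s).
Proof.
move=> s1; have [D0|[i]] := finset.set_0Vmem (Des s); last first.
  (* At a descent the larger entry is a threshold that separates the two entries. *)
  rewrite DesP => /andP[i_n lt_s]; exists (s i).
  apply: (@unsorted_corner _ _ i); rewrite nth_mkseq //.
    by rewrite entryE.
  by rewrite -ltnNge -(entryE s i).
(* Without descents the entries increase strictly, and [n] increasing values below [n] must be
   [0, ..., n.-1]. *)
have incr j : (j.+1 < n)%N -> (entry s j < entry s j.+1)%N.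
  move=> jn; have jn' := ltnW jn; have := finset.in_set0 (Ordinal jn').
  rewrite -D0 DesP /= jn /= => /negbT; rewrite -leqNgt leq_eqVlt => /predU1P[|//].
  rewrite -[j]/(val (Ordinal jn')) -[j.+1]/(val (Ordinal jn)) !entryE => /val_inj.
  by move=> /perm_inj /(congr1 val) /=; lia.
have low j : (j < n)%N -> (j <= entry s j)%N.
  elim: j => // j IH jn; apply: leq_ltn_trans (incr j jn); apply: IH; exact: ltnW.
have high m j : (j + m < n)%N -> (entry s j + m <= entry s (j + m))%N.
  elim: m => [|m IH]; first by rewrite !addn0.
  rewrite !addnS => jm; apply: leq_ltn_trans (incr _ jm).
  by apply: IH; apply: ltnW.
case/eqP: s1; apply/permP => i; rewrite perm1; apply: val_inj => /=.
have i_n := ltn_ord i; rewrite -entryE.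
have jn : (n.-1 < n)%N by lia.
have := high (n.-1 - i)%N i; have := low i i_n.
have -> : (i + (n.-1 - i) = Ordinal jn)%N by rewrite /=; lia.
have := ltn_ord (s (Ordinal jn)); rewrite -entryE /=; lia.
Qed.

(** Markov's inequality for the potential at each threshold [k], then a union bound. As [L]
    dominates both [A / m] and [1 / B], the [n - k] letters [true] and the [k] letters [false]
    together give [L ^+ n], whatever [k] is. *)
Lemma alive_tail n (R : realType) (p q x A L : R) (N t : nat) :
  0 < q -> q < 1 -> 1 <= x -> p = 1 - q ^+ 2 -> (0 < N)%N ->
  (forall M, geo q M (fun i => x ^+ i.+1) <= A) ->
  A <= L * (1 - q ^+ N) -> 1 <= L * geo q N (fun j => (x ^+ j.+1)^-1) ->
  \sum_s alive n p t s <= n%:R * (L ^+ n / x ^+ t).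
Proof.
move=> q0 q1 x1 pE N0 hA AL BL; set B := geo q N _ in BL; set m := 1 - q ^+ N in AL.
have x0 : 0 < x by exact: lt_le_trans x1.
have m0 : 0 < m by rewrite subr_gt0 exprn_ilt1 // ?ltW // -lt0n.
have A0 : 0 <= A.
  by apply: le_trans (hA 0%N); rewrite /geo big_ord0.
have L0 : 0 <= L by rewrite -(pmulr_lge0 _ m0); exact: le_trans AL.
have B0 : 0 < B.
  rewrite ltNge; apply/negP => Bneg.
  by have := lt_le_trans ltr01 BL; rewrite ltNge mulr_ge0_le0.
have tail (k : 'I_n) :
    \sum_(s | unsorted false (word k s)) alive n p t s <= L ^+ n / x ^+ t.
  have kn := ltnW (ltn_ord k).
  have LB0 : 0 < B ^+ k * m ^+ (n - k) by rewrite mulr_gt0 // exprn_gt0.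
  rewrite -(ler_pM2r LB0) big_distrl /=.
  apply: (@le_trans _ _ (\sum_s alive n p t s * potential q x N (word k s) false 1 0)).
    rewrite [leRHS](bigID (fun s => unsorted false (word k s))) /=.
    apply: ler_wpDr.
      apply: sumr_ge0 => s _; apply: mulr_ge0; first exact: (alive_ge0 q0 q1 pE).
      exact: potential_ge0.
    apply: ler_sum => s us; apply: ler_wpM2l; first exact: (alive_ge0 q0 q1 pE).
    have := @potential_unsorted _ _ _ q0 q1 x1 N _ _ 1 0 us ler01 (lexx _).
    by rewrite mul1r count_word // count_negb_word.
  apply: le_trans (alive_potential q0 q1 pE x1 _ _ _ _ ler01) _.
  rewrite word_dec //; apply: le_trans (potential_decreasing q0 q1 x1 _ _ _ (hA _) _) _.
    by rewrite divr_ge0 // exprn_ge0 // ltW.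
  rewrite mul1r [L ^+ n / _]mulrC -mulrA; apply: ler_wpM2l.
    by rewrite invr_ge0 exprn_ge0 // ltW.
  have -> : L ^+ n = L ^+ (n - k) * L ^+ k by rewrite -exprD subnK.
  have -> : L ^+ (n - k) * L ^+ k * (B ^+ k * m ^+ (n - k))
      = (L * m) ^+ (n - k) * (L * B) ^+ k by rewrite !exprMn; ring.
  rewrite -[A ^+ _]mulr1; apply: ler_pM; rewrite ?exprn_ge0 //.
    by apply: lerXn2r; rewrite // nnegrE // mulr_ge0 // ltW.
  exact: exprn_ege1.
apply: (@le_trans _ _ (\sum_(k < n) \sum_(s | unsorted false (word k s)) alive n p t s)).
  under [leRHS]eq_bigr do rewrite big_mkcond.
  rewrite exchange_big; apply: ler_sum => s _ /=.
  have [->|/unsorted_word[k us]] := eqVneq s 1%g.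
    by rewrite alive_id sumr_ge0 // => k _; case: ifP.
  rewrite (bigD1 k) //= us lerDl sumr_ge0 // => k' _.
  by case: ifP => // _; exact: (alive_ge0 q0 q1 pE).
apply: le_trans (ler_sum _ (fun k _ => tail k)) _.
by rewrite sumr_const card_ord mulr_natl.
Qed.

(** Terms before [t0] are bounded by 1, the later ones by the geometric series. *)
Lemma sum_le_of_geometric_tail (R : realType) (a : nat -> R) (c z : R) (t0 M : nat) :
  0 <= z -> z < 1 -> 0 <= c -> (forall t, 0 <= a t <= 1) ->
  (forall t, a t <= c * z ^+ t) ->
  \sum_(t < M) a t <= t0%:R + c * z ^+ t0 / (1 - z).
Proof.
move=> z0 z1 c0 a01 ac.
have z1' : 0 < 1 - z by rewrite subr_gt0.
have bound u : \sum_(t < t0 + u) a t <= t0%:R + c * z ^+ t0 * (1 - z ^+ u) / (1 - z).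
  elim: u => [|u IH].
    rewrite addn0 expr0 subrr mulr0 mul0r addr0.
    apply: (@le_trans _ _ (\sum_(t < t0) 1)); last by rewrite sumr_const card_ord.
    by apply: ler_sum => t _; have /andP[] := a01 t.
  rewrite addnS big_ord_recr /=; apply: le_trans (lerD IH (ac _)) _.
  rewrite -addrA lerD2l exprD le_eqVlt; apply/orP; left; apply/eqP.
  by rewrite exprS; field; rewrite gt_eqF.
apply: (@le_trans _ _ (\sum_(t < t0 + M) a t)).
  rewrite addnC big_split_ord /= lerDl sumr_ge0 // => t _.
  by have /andP[] := a01 (M + t)%N.
apply: le_trans (bound M) _; rewrite lerD2l; apply: ler_wpM2r.
  by rewrite invr_ge0 ltW.
by apply: ler_piMr; rewrite ?mulr_ge0 ?exprn_ge0 // gerBl exprn_ge0.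
Qed.

(* The Chernoff parameter [expR d] is taken close to [1], where both moment
   generating factors are [1 + d / (1 - q) + o(d)]. *)
Lemma tail_parameters (R : realType) (q e : R) : 0 < q -> q < 1 -> 0 < e ->
  exists (d A : R) (N : nat), let L := expR (d * ((1 - q)^-1 + e)) in
  [/\ 0 < d, (0 < N)%N, forall M, geo q M (fun i => expR d ^+ i.+1) <= A,
      A <= L * (1 - q ^+ N) &
      1 <= L * geo q N (fun j => (expR d ^+ j.+1)^-1)].
Proof.
move=> q0 q1 e0; set g := 1 - q.
have g0 : 0 < g by rewrite subr_gt0.
(* Half of the slack [e] covers the second-order terms in [d], the other half the truncation factor
   [1 - q ^+ N]. *)
set D := g^-1 + e / 2.
have D0 : 0 < D by rewrite addr_gt0 ?invr_gt0 ?divr_gt0.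
have Dg : D^-1 < g.
  by rewrite -[ltRHS]invrK ltf_pV2 ?posrE ?invr_gt0 // ltrDl divr_gt0.
(* This choice gives [1 - d - q = D^-1]; with [x * (1 - d) <= 1] it yields the bound [step]. *)
pose d := g - D^-1.
have d0 : 0 < d by rewrite subr_gt0.
set x := expR d.
have x0 : 0 < x := expR_gt0 _.
have x1 : 1 <= x by rewrite -expR0 ler_expR ltW.
have xd : x * (1 - d) <= 1.
  rewrite -[leRHS](mulfV (lt0r_neq0 x0)) ler_pM2l // -expRN.
  exact: expR_ge1Dx.
have qxD : x / D <= 1 - q * x.
  have -> : x / D = x * (1 - d) - q * x by rewrite /d /g; ring.
  by rewrite lerD2r.
have qx : 0 < 1 - q * x by apply: lt_le_trans qxD; rewrite divr_gt0.
have step : (x - 1) / (1 - q * x) <= d * D.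
  rewrite ler_pdivrMr //; apply: (@le_trans _ _ (d * D * (x / D))).
    have -> : d * D * (x / D) = x - x * (1 - d) by field; rewrite gt_eqF.
    by rewrite lerD2l lerN2.
  by rewrite ler_pM2l // mulr_gt0.
have Ale : 1 + (x - 1) / (1 - q * x) <= expR (d * D).
  by apply: le_trans (expR_ge1Dx _); rewrite lerD2l.
have Ble : 1 + (x - 1) / (1 - q) <= expR (d * D).
  apply: le_trans Ale; rewrite lerD2l ler_wpM2l ?subr_ge0 //.
  by rewrite lef_pV2 ?posrE // lerD2l lerN2 ler_peMr // ltW.
have [N N0 qN] : exists2 N, (0 < N)%N & expR (- (d * (e / 2))) <= 1 - q ^+ N.
  have q_norm : `|q| < 1 by rewrite gtr0_norm.
  have t0 : 0 < 1 - expR (- (d * (e / 2))).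
    by rewrite subr_gt0 -expR0 ltr_expR oppr_lt0 mulr_gt0 // divr_gt0.
  have /cvgr0_norm_lt/(_ _ t0) [N0 _ HN] := cvg_expr q_norm.
  exists N0.+1 => //; have := HN N0.+1 (leqnSn _) => /=.
  by rewrite ger0_norm ?exprn_ge0 ?(ltW q0) // => qN; lra.
have LE : expR (d * (g^-1 + e)) * expR (- (d * (e / 2))) = expR (d * D).
  by rewrite -expRD; congr expR; rewrite /D; field; rewrite gt_eqF.
exists d, (1 + (x - 1) / (1 - q * x)), N => L; split=> //.
- move=> M; apply: geo_expr_le => //; by rewrite -subr_gt0.
- apply: le_trans Ale _; rewrite -LE ler_pM2l ?expR_gt0 //.
- apply: le_trans (ler_wpM2l (expR_ge0 _) (geo_exprV_ge q0 q1 x1 N)).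
  have Bpos : 0 < 1 + (x - 1) / (1 - q).
    by rewrite ltr_wpDr // divr_ge0 ?subr_ge0 // ltW.
  rewrite mulrA ler_pdivlMr // mul1r; apply: le_trans Ble _.
  by rewrite -LE ler_pM2l ?expR_gt0.
Qed.

Theorem theorem1p3 (R : realType) (p : R) : 0 < p < 1 ->
  forall eps : R, 0 < eps -> exists N : nat, forall n : nat, (N <= n)%N ->
    (expected_steps n p <=
       (((1 + Num.sqrt (1 - p)) / p + eps) * n%:R)%:E)%E.
Proof.
move=> /andP[p0 p1] eps eps0; set q := Num.sqrt (1 - p).
have p1' : 0 < 1 - p by rewrite subr_gt0.
have q2 : q ^+ 2 = 1 - p by rewrite sqr_sqrtr // ltW.
have q0 : 0 < q by rewrite sqrtr_gt0.
have q1 : q < 1.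
  by rewrite /q -[ltRHS]sqrtr1 ltr_sqrt // ltrBlDr ltrDl.
have pE : p = 1 - q ^+ 2 by rewrite q2; ring.
(* Here [p] factors as [(1 - q) * (1 + q)]. *)
have -> : (1 + q) / p = (1 - q)^-1.
  rewrite pE; field; apply/andP; split; rewrite gt_eqF //; first by rewrite subr_gt0.
  by rewrite -pE.
set C := (1 - q)^-1; have C0 : 0 < C by rewrite invr_gt0 subr_gt0.
(* One third of [eps] goes into the rate in [L], one absorbs the factor [n] of the union bound, and
   one absorbs the constant [1 + K]. *)
have e0 : 0 < eps / 3 by rewrite divr_gt0.
have [d [A [N [d0 N0 hA AL BL]]]] := tail_parameters q0 q1 e0.
set x := expR d in hA BL; set L := expR (d * _) in AL BL.
have x1 : 1 <= x by rewrite -expR0 ler_expR ltW.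
pose z := expR (- d).
have z1 : z < 1 by rewrite -expR0 ltr_expR oppr_lt0.
pose K := (d * (eps / 3))^-1 / (1 - z).
have K0 : 0 <= K.
  by rewrite divr_ge0 ?subr_ge0 ?invr_ge0 ?mulr_ge0 // ltW.
exists (Num.truncn ((1 + K) / (eps / 3))).+1 => n Nn.
have nbig : 1 + K <= eps / 3 * n%:R.
  rewrite mulrC -ler_pdivrMr //; apply: ltW; apply: lt_le_trans (_ : _ <= n%:R).
    by apply: truncnS_gt.
  by rewrite ler_nat.
pose a t := \sum_s alive n p t s.
have a01 t : 0 <= a t <= 1.
  rewrite (alive_sum_le1 q0 q1 pE) andbT.
  by apply: sumr_ge0 => s _; exact: (alive_ge0 q0 q1 pE).
pose c := n%:R * L ^+ n.
have c0 : 0 <= c by rewrite mulr_ge0 // exprn_ge0 // expR_ge0.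
have ac t : a t <= c * z ^+ t.
  apply: le_trans (alive_tail n t q0 q1 x1 pE N0 hA AL BL) _.
  by rewrite /z expRN exprVn mulrA.
pose y := (C + eps / 3 + eps / 3) * n%:R.
have y0 : 0 <= y by rewrite mulr_ge0 // ltW // !addr_gt0.
pose t0 := (Num.truncn y).+1.
have yt0 : y <= t0%:R by apply: ltW; apply: truncnS_gt.
have t0y : t0%:R <= y + 1 by rewrite -natr1 lerD2r truncn_le.
have czK : c * z ^+ t0 / (1 - z) <= K.
  apply: ler_wpM2r; first by rewrite invr_ge0 subr_ge0 ltW.
  rewrite -[leRHS]mul1r ler_pdivlMr ?mulr_gt0 //.
  (* The factor [n] is absorbed through [u <= expR u] with [u = d * (eps / 3) * n]; the choice of
     [t0] makes the total exponent nonpositive. *)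
  apply: (@le_trans _ _ (expR (d * (eps / 3) * n%:R) * (L ^+ n * z ^+ t0))).
    have -> : c * z ^+ t0 * (d * (eps / 3)) = d * (eps / 3) * n%:R * (L ^+ n * z ^+ t0).
      by rewrite /c; ring.
    apply: ler_wpM2r; first by rewrite mulr_ge0 // exprn_ge0 // expR_ge0.
    by apply: le_trans (expR_ge1Dx _); rewrite lerDr.
  rewrite -!expRM_natr -!expRD -[leRHS]expR0 ler_expR.
  have := ler_wpM2l (ltW d0) yt0; rewrite /y -/C; lra.
apply: lime_le.
  by apply: is_cvg_nneseries => t _ _; rewrite lee_fin; have /andP[] := a01 t.
apply: nearW => M; rewrite sumEFin lee_fin big_mkord.
apply: le_trans (sum_le_of_geometric_tail t0 M (expR_ge0 _) z1 c0 a01 ac) _.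
apply: le_trans (lerD t0y czK) _; rewrite /y; lra.
Qed.
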